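(* For every real $c>0$ there exist positive real numbers $A$ and $B$, depending only on $c$, and a constant $C>0$, depending only on $c$, such that the following holds. Let $X>2$ be real and let $\alpha\in\mathbb{R}$ be such that $$\alpha=\frac{a}{q}+\frac{\theta}{q^2},\quad (a,q)=1,\quad |\theta|<1,\quad (\log X)^A<q\le X(\log X)^{-B},$$ for some integers $a$ and $q\ge 1$ and some real $\theta$. Then $$\left|\sum_{n\le X}\varepsilon(n)e^{2\pi i\alpha n^2}\right|\le C\,X(\log X)^{-c},$$ where the sum is over positive integers $n\le X$.
   Context: Every positive integer $n$ has a binary expansion $n=\sum_{k\ge 0}\varepsilon_k 2^k$ with $\varepsilon_k\in\{0,1\}$. Let $\mathbb{N}_0$ be the set of positive integers $n$ for which $\sum_k\varepsilon_k$ is even. The function $\varepsilon$ on positive integers is defined by $\varepsilon(n)=1$ if $n\in\mathbb{N}_0$ and $\varepsilon(n)=-1$ otherwise. Here $(a,q)$ is the greatest common divisor and $\log$ is the natural logarithm. *)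

(* Defs.v *)
From mathcomp Require Import all_boot all_order all_algebra.
From mathcomp Require Import all_classical all_reals all_analysis.
From mathcomp Require Export complex.
Set Implicit Arguments.
Unset Strict Implicit.
Unset Printing Implicit Defensive.
Import Order.TTheory GRing.Theory Num.Theory.

Local Open Scope ring_scope.
Local Open Scope complex_scope.

Definition binary_digit (n k : nat) : nat := ((n %/ 2 ^ k) %% 2)%N.

(* As n < 2 ^ n, the digits of n of index k >= n vanish, so summing over k < n
   loses nothing; see binary_digit_large and binary_expansion. *)
Definition binary_digit_sum (n : nat) : nat :=
  (\sum_(k < n) binary_digit n k)%N.

Lemma binary_digit_large (n k : nat) : (n <= k)%N -> binary_digit n k = 0%N.
Proof.
by move=> nk; rewrite /binary_digit divn_small// (leq_ltn_trans nk)// ltn_expl.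
Qed.

Lemma binary_expansion (n : nat) :
  n = (\sum_(k < n) binary_digit n k * 2 ^ k)%N.
Proof.
have H m : (\sum_(k < m) binary_digit n k * 2 ^ k + n %/ 2 ^ m * 2 ^ m = n)%N.
  elim: m => [|m IH]; first by rewrite big_ord0 expn0 divn1 muln1.
  rewrite big_ord_recr/= -[RHS]IH -addnA; congr (_ + _)%N.
  rewrite expnSr divnMA [(2 ^ m * 2)%N]mulnC mulnA -mulnDl addnC.
  by rewrite /binary_digit -divn_eq.
have n0 : (n %/ 2 ^ n = 0)%N.
  by apply: divn_small; apply: ltn_expl.
by move: (H n); rewrite n0 mul0n addn0 => /esym.
Qed.

Definition N0 : pred nat :=
  [pred n | (0 < n)%N && ~~ odd (binary_digit_sum n)].

Definition eps (R : realType) (n : nat) : R[i] :=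
  if n \in N0 then 1 else -1.

(* The complex exponential e^(i t) of a real number t, by Euler's formula. *)
Definition expi (R : realType) (t : R) : R[i] := cos t +i* sin t.

(* For X >= 0, a natural number n satisfies n <= X iff n <= Num.truncn X. *)
Definition weyl_sum_eps (R : realType) (X alpha : R) : R[i] :=
  \sum_(1 <= n < (Num.truncn X).+1)
    eps R n * expi (2 * pi * alpha * n%:R ^+ 2).

(* Main.v *)
Require Import Defs.
From mathcomp Require Import all_boot all_order all_algebra.
From mathcomp Require Import all_classical all_reals all_analysis.
From mathcomp Require Import ring lra zify.
Import Order.TTheory GRing.Theory Num.Theory numFieldNormedType.Exports.
Local Open Scope ring_scope.
Local Open Scope complex_scope.

(** The sign of eps is multiplicative across a cut of the binary expansion:
    if R = 2 ^ k and r < R, the digits of m * R + r are those of r followed by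
    those of m, so the sign of m * R + r is the product of the signs of m and
    r ([thue_morse_shift]).  As
      (m R + r)^2 = m^2 R^2 + 2 R m r + r^2,
    the sum over n < M R becomes a bilinear form
      sum_m sum_r a_m b_r e(2 R alpha m r)
    with coefficients of modulus at most one, and nothing more needs to be
    known about them.  By Cauchy-Schwarz in m, the square of its modulus is at
    most M times a sum over pairs (r, r') of geometric sums in m of ratio
    e(2 R alpha (r - r')) ([bilinear_bound]).  The M-term sums with r = r'
    contribute M R in total.  For r <> r', set l = 2 R (r - r').
    If q is larger than 64 R^2, then q does not divide l, so e(l a / q) is
    a q-th root of unity other than 1, at distance at least 1 / q from 1
    ([unity_root_dist]); replacing a / q by alpha moves this point by at most
    1 / (2 q), and the geometric sum is O(q) ([expi_dist]).  Altogether
    |sum|^2 <= M (R M + 4 R^2 q) <= X^2 / R + 4 X R q.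
    With R between (log X)^(2c) and 2 (log X)^(2c), the hypotheses on q for
    A = 4c + 1 and B = 4c give 64 R^2 < q and make both terms
    O(X^2 (log X)^(-2c)).  This needs log X >= 256; for smaller X
    the trivial bound X suffices, at the price of a larger constant. *)

(** * The Thue-Morse sign *)

Definition thue_morse (C : nzRingType) (n : nat) : C :=
  (-1) ^+ binary_digit_sum n.

Lemma eps_thue_morse (R : realType) (n : nat) :
  (0 < n)%N -> eps R n = thue_morse R[i] n.
Proof.
move=> n0; rewrite /eps /thue_morse /N0 inE n0 /= -signr_odd.
by case: odd; rewrite ?expr0 ?expr1.
Qed.

Lemma norm_thue_morse (C : numDomainType) (n : nat) : `|thue_morse C n| = 1.
Proof. by rewrite /thue_morse normrX normrN1 expr1n. Qed.

Lemma binary_digit_sum_widen (n K : nat) :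
  (n <= K)%N -> binary_digit_sum n = (\sum_(0 <= k < K) binary_digit n k)%N.
Proof.
move=> nK; rewrite /binary_digit_sum -(big_mkord xpredT (binary_digit n)).
rewrite (@big_cat_nat _ _ _ n 0 K)//=.
rewrite [X in (_ + X)%N]big_nat_cond [X in (_ + X)%N]big1 ?addn0//.
by move=> k /andP[/andP[nk _] _]; rewrite binary_digit_large.
Qed.

Lemma binary_digit_low (k m r j : nat) :
  (j < k)%N -> binary_digit (m * 2 ^ k + r) j = binary_digit r j.
Proof.
move=> jk; rewrite /binary_digit.
have -> : (2 ^ k = 2 ^ (k - j).-1 * 2 * 2 ^ j)%N.
  by rewrite -expnSr prednK ?subn_gt0// -expnD subnK// ltnW.
by rewrite !mulnA divnMDl ?expn_gt0// modnMDl.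
Qed.

Lemma binary_digit_high (k m r j : nat) :
  (r < 2 ^ k)%N -> binary_digit (m * 2 ^ k + r) (j + k) = binary_digit m j.
Proof.
move=> rk; rewrite /binary_digit [(j + k)%N]addnC expnD divnMA.
by rewrite divnMDl ?expn_gt0// (divn_small rk) addn0.
Qed.

Lemma binary_digit_sum_shift (k m r : nat) : (r < 2 ^ k)%N ->
  binary_digit_sum (m * 2 ^ k + r) =
  (binary_digit_sum m + binary_digit_sum r)%N.
Proof.
move=> rk.
set N := (m * 2 ^ k + r)%N.
have NK : (N <= N + k)%N by rewrite leq_addr.
have mN : (m <= N)%N.
  by rewrite /N (leq_trans (leq_pmulr m (expn_gt0 2 k)))// leq_addr.
have rN : (r <= N + k)%N by rewrite (leq_trans _ NK)// /N leq_addl.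
rewrite (@binary_digit_sum_widen N (N + k))// (@binary_digit_sum_widen m N)//.
rewrite (@binary_digit_sum_widen r (N + k))//.
rewrite (@big_cat_nat _ _ _ k 0 (N + k)) ?leq_addl//=.
rewrite [in RHS](@big_cat_nat _ _ _ k 0 (N + k)) ?leq_addl//=.
rewrite [X in (_ + (_ + X))%N]big_nat_cond [X in (_ + (_ + X))%N]big1 => [|j].
  rewrite addn0 addnC; congr (_ + _)%N.
    rewrite -{1}[k]add0n big_addn addnK.
    by apply: eq_bigr => j _; rewrite binary_digit_high.
  by apply: eq_big_nat => j /andP[_ jk]; rewrite binary_digit_low.
move=> /andP[/andP[kj _] _]; rewrite /binary_digit divn_small ?mod0n//.
by rewrite (leq_trans rk)// leq_exp2l.
Qed.

Lemma thue_morse_shift (C : nzRingType) (k m r : nat) : (r < 2 ^ k)%N ->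
  thue_morse C (m * 2 ^ k + r) = thue_morse C m * thue_morse C r.
Proof. by move=> rk; rewrite /thue_morse binary_digit_sum_shift// exprD. Qed.

(** * Bilinear forms and geometric sums *)

Lemma sqr_sum_le (C : numDomainType) (M : nat) (x : 'I_M -> C) :
  (forall i, 0 <= x i) ->
  (\sum_(i < M) x i) ^+ 2 <= M%:R * \sum_(i < M) x i ^+ 2.
Proof.
move=> x0.
have xr i : x i \is Num.real by rewrite ger0_real.
rewrite -(@ler_pMn2r _ 2)// expr2 mulr_suml.
under eq_bigr do rewrite mulr_sumr.
rewrite -sumrMnl; under eq_bigr do rewrite -sumrMnl.
have -> : (M%:R * \sum_(i < M) x i ^+ 2) *+ 2 =
    \sum_(i < M) \sum_(j < M) (x i ^+ 2 + x j ^+ 2).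
  under [RHS]eq_bigr do rewrite big_split sumr_const card_ord /=.
  by rewrite big_split/= sumr_const card_ord sumrMnl mulr_natl mulr2n.
apply: ler_sum => i _; apply: ler_sum => j _.
by have [] := real_leif_mean_square_scaled (xr i) (xr j).
Qed.

Lemma geometric_sum_le (C : numDomainType) (w : C) (M : nat) :
  `|w| = 1 -> `|1 - w| * `|\sum_(i < M) w ^+ i| <= 2.
Proof.
move=> w1; rewrite distrC -normrM -subrX1 (le_trans (ler_normB _ _))//.
by rewrite normrX w1 expr1n normr1.
Qed.

(** Points z r of the unit circle that are D-separated make the powers z r ^+ m
    nearly orthogonal in r: expanding the square after Cauchy-Schwarz leaves,
    for each pair of distinct indices, a geometric sum of size at most 2 / D. *)
Lemma bilinear_bound (C : numClosedFieldType) (M K : nat) (a : nat -> C)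
    (b z : 'I_K -> C) (D : C) :
  (forall m, `|a m| <= 1) -> (forall r, `|b r| <= 1) ->
  (forall r, `|z r| = 1) -> 0 < D ->
  (forall r r', r != r' -> D <= `|z r - z r'|) ->
  `|\sum_(m < M) a m * \sum_(r < K) b r * z r ^+ m| ^+ 2 <=
  M%:R * (K%:R * (M%:R + K%:R * (2 / D))).
Proof.
move=> a1 b1 z1 D0 zD.
pose T (m : 'I_M) := \sum_(r < K) b r * z r ^+ m.
have G r r' : `|\sum_(m < M) (z r * (z r')^*) ^+ m| <=
    (if r' == r then M%:R else 0) + 2 / D.
  have w1 : `|z r * (z r')^*| = 1 by rewrite normrM norm_conjC !z1 mulr1.
  have D2 : 0 <= 2 / D by rewrite divr_ge0// ltW.
  case: (eqVneq r' r) => [_|rr].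
    rewrite (le_trans (ler_norm_sum _ _ _))//.
    under eq_bigr do rewrite normrX w1 expr1n.
    by rewrite sumr_const card_ord lerDl.
  rewrite add0r ler_pdivlMr// mulrC (le_trans _ (geometric_sum_le _ _ M w1))//.
  rewrite ler_wpM2r// (le_trans (zD _ _ rr))//.
  have -> : 1 - z r * (z r')^* = (z r' - z r) * (z r')^*.
    by rewrite mulrBl -normCK z1 expr1n.
  by rewrite normrM norm_conjC z1 mulr1.
apply: (@le_trans _ _ ((\sum_(m < M) `|T m|) ^+ 2)).
  rewrite lerXn2r ?nnegrE ?sumr_ge0//.
  rewrite (le_trans (ler_norm_sum _ _ _))//; apply: ler_sum => m _.
  by rewrite normrM ler_piMl.
apply: (le_trans (sqr_sum_le _ _ _ _)) => //.
rewrite ler_wpM2l//.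
have S0 : 0 <= \sum_(m < M) `|T m| ^+ 2.
  by rewrite sumr_ge0// => m _; rewrite exprn_ge0.
rewrite -(ger0_norm S0).
have -> : \sum_(m < M) `|T m| ^+ 2 = \sum_(r < K) \sum_(r' < K)
    b r * (b r')^* * \sum_(m < M) (z r * (z r')^*) ^+ m.
  transitivity (\sum_(m < M) \sum_(r < K) \sum_(r' < K)
      b r * (b r')^* * (z r * (z r')^*) ^+ m).
    apply: eq_bigr => m _; rewrite normCK /T mulr_suml; apply: eq_bigr => r _.
    rewrite rmorph_sum mulr_sumr; apply: eq_bigr => r' _ /=.
    by rewrite rmorphM rmorphXn exprMn; ring.
  rewrite exchange_big; apply: eq_bigr => r _ /=.
  by rewrite exchange_big; apply: eq_bigr => r' _ /=; rewrite mulr_sumr.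
apply: (@le_trans _ _ (\sum_(r < K) (M%:R + K%:R * (2 / D)))); last first.
  by rewrite sumr_const card_ord -[leLHS]mulr_natl.
rewrite (le_trans (ler_norm_sum _ _ _))//; apply: ler_sum => r _.
rewrite (le_trans (ler_norm_sum _ _ _))//.
apply: (@le_trans _ _
  (\sum_(r' < K) ((if r' == r then M%:R else 0) + 2 / D))); last first.
  rewrite big_split/= -big_mkcond/= big_pred1_eq sumr_const card_ord.
  by rewrite -[_ *+ K]mulr_natl.
apply: ler_sum => r' _; rewrite normrM (le_trans _ (G r r'))// ler_piMl//.
by rewrite normrM norm_conjC mulr_ile1.
Qed.

(** * Distance to roots of unity *)

(** The powers of w sum to zero over a full period, so the q numbers 1 - w ^+ k
    sum to q; each of them is at most q times as large as 1 - w. *)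
Lemma unity_root_dist (C : numFieldType) (w : C) (q : nat) :
  (0 < q)%N -> w ^+ q = 1 -> w != 1 -> `|w| = 1 -> 1 <= q%:R * `|1 - w|.
Proof.
move=> q0 wq w_neq1 w1.
have qC : 0 < q%:R :> C by rewrite ltr0n.
have sum0 : \sum_(k < q) w ^+ k = 0.
  apply: (mulfI (x := w - 1)); first by rewrite subr_eq0.
  by rewrite -subrX1 wq subrr mulr0.
have sumq : \sum_(k < q) (1 - w ^+ k) = q%:R.
  by rewrite sumrB sum0 subr0 sumr_const card_ord.
rewrite -(ler_pM2l qC) mulr1 -[leLHS](normr_nat C q) -[X in `|X| <= _]sumq.
rewrite (le_trans (ler_norm_sum _ _ _))// [leRHS]mulr_natl.
rewrite -[X in _ <= _ *+ X]card_ord -sumr_const; apply: ler_sum => k _.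
rewrite distrC subrX1 normrM distrC mulrC ler_wpM2r//.
rewrite (le_trans (ler_norm_sum _ _ _))//.
under eq_bigr do rewrite normrX w1 expr1n.
by rewrite sumr_const card_ord ler_nat ltnW.
Qed.

Section Expi.
Variable R : realType.
Implicit Types s t : R.

Lemma expiD s t : expi (s + t) = expi s * expi t.
Proof.
by apply/eqP; rewrite eq_complex /= cosD sinD !eqxx /= addrC eqxx.
Qed.

Lemma expi0 : expi (0 : R) = 1.
Proof. by rewrite /expi cos0 sin0. Qed.

Lemma norm_expi t : `|expi t| = 1.
Proof. by rewrite normc_def /= cos2Dsin2 sqrtr1. Qed.

Lemma expi_natmul t n : expi (t * n%:R) = expi t ^+ n.
Proof.
elim: n => [|n IH]; first by rewrite mulr0 expi0 expr0.
by rewrite mulrSr mulrDr mulr1 expiD IH exprSr.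
Qed.

Lemma expi_int (k : int) : expi (2 * pi * k%:~R : R) = 1.
Proof.
have H n : expi (2 * pi * n%:R : R) = 1.
  have e : expi (2 * pi : R) = 1.
    by rewrite mulr_natl /expi cos2pi sin2pi.
  by rewrite expi_natmul e expr1n.
case: k => n; first exact: H.
have := expiD (2 * pi * n.+1%:R) (2 * pi * (Negz n)%:~R).
by rewrite H mul1r NegzE mulrNz mulrN subrr expi0.
Qed.

Lemma dist_expi s t : `|expi s - expi t| = `|1 - expi (s - t)|.
Proof.
have -> : expi s - expi t = (expi (s - t) - 1) * expi t.
  by rewrite mulrBl mul1r -expiD subrK.
by rewrite normrM norm_expi mulr1 distrC.
Qed.

Lemma expi_neq1 (p q : int) : 0 < q -> ~~ (q %| p)%Z ->
  expi (2 * pi * (p%:~R / q%:~R) : R) != 1.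
Proof.
move=> q0 qp.
have qR : 0 < q%:~R :> R by rewrite ltr0z.
set r := (p %% q)%Z.
have r0 : 0 < r.
  have r_ge0 : 0 <= r by rewrite modz_ge0 ?gt_eqF.
  rewrite lt_neqAle r_ge0 andbT eq_sym.
  by apply: contra qp => /eqP ?; apply/dvdz_mod0P.
have rq : r < q by rewrite ltz_pmod.
have -> : 2 * pi * (p%:~R / q%:~R) =
    2 * pi * (p %/ q)%Z%:~R + (pi * (r%:~R / q%:~R)) *+ 2 :> R.
  have -> : p%:~R = (p %/ q)%Z%:~R * q%:~R + r%:~R :> R.
    by rewrite {1}(divz_eq p q) intrD intrM.
  by field; rewrite gt_eqF.
rewrite expiD expi_int mul1r; apply/eqP => -[].
set y := pi * _; rewrite cos_mulr2n => /eqP.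
have sy : 0 < sin y.
  apply: sin_gt0_pi; rewrite /y mulr_gt0 ?pi_gt0 ?divr_gt0 ?ltr0z//=.
  by rewrite gtr_pMr ?pi_gt0// ltr_pdivrMr// mul1r ltr_int.
rewrite cos2sin2 => /eqP c1 _.
have : sin y ^+ 2 = 0 by move: c1; rewrite mulrnBl; lra.
by move/eqP; rewrite sqrf_eq0 gt_eqF.
Qed.

Lemma lipschitz1 (f df : R -> R) t :
  (forall x : R, is_derive x 1 f (df x)) -> (forall x, `|df x| <= 1) ->
  `|f t - f 0| <= `|t|.
Proof.
move=> fd df1.
have fc (a b : R) : {within `[a, b], continuous f}%classic.
  apply: continuous_subspaceT => x; apply/differentiable_continuous.
  by apply/derivable1_diffP; apply: ex_derive.
have H (a b : R) : a <= b -> `|f b - f a| <= `|b - a|.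
  move=> ab; have [c _ ->] := MVT_segment ab (fun x _ => fd x) (fc a b).
  by rewrite normrM ler_piMl.
have [t0|t0] := leP 0 t; first by rewrite (le_trans (H _ _ t0))// subr0.
by rewrite distrC (le_trans (H _ _ (ltW t0)))// sub0r normrN.
Qed.

Lemma dist1_expi t : `|1 - expi t| <= (2 * `|t|)%:C.
Proof.
have hc : `|1 - cos t| <= `|t|.
  rewrite distrC -{1}(@cos0 R); apply: (@lipschitz1 cos (fun x => - sin x)).
  by move=> x; rewrite normrN sin_max.
have hs : `|sin t| <= `|t|.
  rewrite -[sin t]subr0 -{1}(@sin0 R); apply: (@lipschitz1 sin cos).
  by move=> x; rewrite cos_max.
rewrite normc_def /= lecR sub0r sqrrN.
rewrite -[leRHS]ger0_norm ?mulr_ge0// -sqrtr_sqr ler_wsqrtr//.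
rewrite -(real_normK (num_real (1 - _))) -(real_normK (num_real (sin _))).
have := normr_ge0 (1 - cos t); have := normr_ge0 (sin t).
have := normr_ge0 t; nra.
Qed.

(** The point e(l a / q) is a nontrivial q-th root of unity, hence at distance
    at least 1 / q from 1; moving from a / q to alpha shifts it by at most
    4 pi |l| / q^2, which is at most half of that when 32 |l| <= q. *)
Lemma expi_dist (a q l : int) (theta : R) :
  1 <= q -> coprimez a q -> `|theta| < 1 -> l != 0 -> 32 * `|l| <= q ->
  ((2 * q%:~R)^-1)%:C <=
  `|1 - expi (2 * pi * (a%:~R / q%:~R + theta / q%:~R ^+ 2) * l%:~R)|.
Proof.
move=> q1 aq th l0 lq.
have q0 : 0 < q by lia.
have qR : 0 < q%:~R :> R by rewrite ltr0z.
have ql : ~~ (q %| l * a)%Z.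
  rewrite Gauss_dvdzl ?(coprimez_sym q)//; apply/negP => /dvdzP[k lk].
  have k1 : 1 <= `|k|.
    rewrite -gtz0_ge1 normr_gt0.
    by apply: contra l0 => /eqP k0; rewrite lk k0 mul0r.
  by move: lq; rewrite lk normrM (gtr0_norm q0); nia.
set w := expi (2 * pi * ((l * a)%:~R / q%:~R) : R).
set t : R := 2 * pi * (theta / q%:~R ^+ 2 * l%:~R).
have -> : 2 * pi * (a%:~R / q%:~R + theta / q%:~R ^+ 2) * l%:~R =
    2 * pi * ((l * a)%:~R / q%:~R) + t :> R.
  by rewrite /t intrM; ring.
rewrite expiD -/w.
have wdist : (q%:~R^-1)%:C <= `|1 - w|.
  have [n nq] : exists n : nat, q = n by exists `|q|%N; lia.
  have wq : w ^+ n = 1.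
    rewrite -expi_natmul nq -mulrA divfK; last by rewrite -nq gt_eqF.
    exact: expi_int.
  have n0 : (0 < n)%N by lia.
  have := @unity_root_dist _ w n n0 wq (@expi_neq1 _ _ q0 ql) (norm_expi _).
  rewrite nq -[n%:R]/(n%:R : R[i]) => H.
  rewrite rmorphV ?unitfE; last by rewrite -nq gt_eqF.
  rewrite rmorph_nat -(@ler_pM2l _ n%:R) ?ltr0n// mulfV ?pnatr_eq0 -?lt0n//.
have tdist : `|w - w * expi t| <= ((2 * q%:~R)^-1)%:C.
  rewrite -{1}[w]mulr1 -mulrBr normrM norm_expi mul1r.
  apply: (le_trans (dist1_expi t)); rewrite lecR /t.
  rewrite !normrM normfV (ger0_norm (pi_ge0 R)) normr_nat.
  rewrite (ger0_norm (exprn_ge0 2 (ltW qR))).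
  have lqR : 32 * `|l%:~R| <= q%:~R :> R.
    by rewrite -intr_norm -(ler_int R) intrM in lq *.
  have pi4 : pi <= 4 :> R by have := @pihalf_lt2 R; lra.
  have e : (2 * q%:~R)^-1 = q%:~R / (2 * q%:~R ^+ 2) :> R.
    by field; rewrite gt_eqF.
  rewrite e ler_pdivlMr ?mulr_gt0 ?exprn_gt0//.
  have -> : 2 * (2 * pi * (`|theta| / q%:~R ^+ 2 * `|l%:~R|)) * (2 * q%:~R ^+ 2)
     = 8 * pi * (`|theta| * `|l%:~R|) :> R.
    by field; rewrite gt_eqF.
  apply: le_trans lqR.
  rewrite -[32]/(8 * 4)%:R natrM.
  have := normr_ge0 theta; have := normr_ge0 (l%:~R : R); have := pi_ge0 R.
  move=> p0 n0 t0.
  apply: ler_pM; rewrite ?mulr_ge0 ?ler_wpM2l//.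
  by rewrite ler_piMl// ltW.
have -> : ((2 * q%:~R)^-1)%:C = (q%:~R^-1)%:C - ((2 * q%:~R)^-1)%:C :> R[i].
  by rewrite -raddfB; congr (_ %:C); field; rewrite gt_eqF.
rewrite lerBlDr (le_trans wdist)//.
have -> : 1 - w = (1 - w * expi t) - (w - w * expi t) by ring.
by rewrite (le_trans (ler_normB _ _))// lerD2l.
Qed.

End Expi.

(** * The sum over n < M 2^k *)

Lemma thue_morse_block_bound (R : realType) (a q : int) (theta : R)
    (k M : nat) :
  let alpha := a%:~R / q%:~R + theta / q%:~R ^+ 2 in
  coprimez a q -> `|theta| < 1 -> 64 * (2 ^ k)%:Z ^+ 2 <= q ->
  `|\sum_(0 <= n < M * 2 ^ k)
      thue_morse R[i] n * expi (2 * pi * alpha * n%:R ^+ 2)| ^+ 2 <=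
  (M%:R * ((2 ^ k)%:R * (M%:R + (2 ^ k)%:R * (4 * q%:~R))))%:C.
Proof.
move=> alpha aq th; set K := (2 ^ k)%N => Kq.
have K0 : (0 < K)%N by rewrite expn_gt0.
have q1 : 1 <= q by nia.
have qR : 0 < q%:~R :> R by rewrite ltr0z; lia.
pose am (m : nat) := thue_morse R[i] m *
  expi (2 * pi * alpha * (m%:R * K%:R) ^+ 2).
pose b (r : 'I_K) := thue_morse R[i] r * expi (2 * pi * alpha * r%:R ^+ 2).
pose z (r : 'I_K) := expi (2 * pi * alpha * (2 * K%:R * r%:R)).
have -> : \sum_(0 <= n < M * K)
      thue_morse R[i] n * expi (2 * pi * alpha * n%:R ^+ 2) =
    \sum_(m < M) am m * \sum_(r < K) b r * z r ^+ m.
  rewrite big_nat_mul big_mkord; apply: eq_bigr => m _.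
  rewrite -{1}[(m * K)%N]add0n big_addn mulSn addnK big_mkord mulr_sumr.
  apply: eq_bigr => r _; rewrite addnC thue_morse_shift// /am /b /z.
  rewrite -expi_natmul.
  rewrite [RHS]mulrACA mulrA -!mulrA; congr (_ * (_ * _)).
  rewrite -!expiD; congr expi.
  by rewrite natrD natrM; ring.
set D : R[i] := ((2 * q%:~R)^-1)%:C.
have D0 : 0 < D by rewrite ltcR invr_gt0 mulr_gt0.
have -> : (M%:R * (K%:R * (M%:R + K%:R * (4 * q%:~R))))%:C =
    M%:R * (K%:R * (M%:R + K%:R * (2 / D))) :> R[i].
  have -> : 2 / D = (4 * q%:~R)%:C.
    rewrite /D -[2]/(2%:R) -(rmorph_nat (real_complex R)) -fmorphV invrK -rmorphM.
    by congr (_%:C); ring.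
  by rewrite !(rmorphM, rmorphD, rmorph_nat).
apply: bilinear_bound => //.
- by move=> m; rewrite normrM norm_thue_morse norm_expi mulr1.
- by move=> r; rewrite normrM norm_thue_morse norm_expi mulr1.
- by move=> r; rewrite norm_expi.
move=> r r' rr; rewrite /z dist_expi.
set l : int := 2 * K%:Z * (r%:Z - r'%:Z).
have -> : 2 * pi * alpha * (2 * K%:R * r%:R) -
    2 * pi * alpha * (2 * K%:R * r'%:R) = 2 * pi * alpha * l%:~R.
  by rewrite /l !(intrM, intrB) -!pmulrn; ring.
have rK := ltn_ord r; have rK' := ltn_ord r'.
have {}rr : r != r' :> nat by [].
apply: expi_dist => //; rewrite /l; first by nia.
rewrite !normrM (ger0_norm (isT : 0 <= 2 :> int)) (ger0_norm (isT : 0 <= K%:Z)).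
have : `|r%:Z - r'%:Z| <= K%:Z by lia.
nia.
Qed.

(** Splitting off the last incomplete block, and the index 0, which is not in
    the range of the Weyl sum, costs at most 2 ^ (k + 1). *)
Lemma weyl_sum_eps_block (R : realType) (X alpha : R) (k : nat) :
  `|weyl_sum_eps X alpha| <=
    `|\sum_(0 <= n < Num.truncn X %/ 2 ^ k * 2 ^ k)
      thue_morse R[i] n * expi (2 * pi * alpha * n%:R ^+ 2)| +
    (2 * 2 ^ k)%:R.
Proof.
set K := (2 ^ k)%N; set N := Num.truncn X; set M := (N %/ K)%N.
have K0 : (0 < K)%N by rewrite expn_gt0.
pose F n := thue_morse R[i] n * expi (2 * pi * alpha * n%:R ^+ 2).
have F1 n : `|F n| = 1 by rewrite normrM norm_thue_morse norm_expi mulr1.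
have MN : (M * K <= N.+1)%N by rewrite (leq_trans (leq_trunc_div _ _)).
have -> : weyl_sum_eps X alpha = \sum_(0 <= n < N.+1) F n - F 0%N.
  rewrite big_ltn// addrC addrA addNr add0r.
  by apply: eq_big_nat => n /andP[n0 _]; rewrite eps_thue_morse.
rewrite (@big_cat_nat _ _ _ (M * K) 0 N.+1)//= -addrA.
rewrite (le_trans (ler_normD _ _))// lerD2l (le_trans (ler_normB _ _))//.
rewrite mulSn mul1n natrD lerD//; last by rewrite F1 ler1n.
rewrite (le_trans (ler_norm_sum _ _ _))//.
under eq_bigr do rewrite F1.
rewrite sumr_const_nat ler_nat /M subSn ?leq_trunc_div//.
by rewrite {1}(divn_eq N K) addKn ltn_pmod.
Qed.

Lemma weyl_sum_eps_trivial (R : realType) (X alpha : R) :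
  0 <= X -> `|weyl_sum_eps X alpha| <= X%:C.
Proof.
move=> X0; apply: (@le_trans _ _ (Num.truncn X)%:R); last first.
  by rewrite -(rmorph_nat (real_complex R)) lecR truncn_le.
rewrite (le_trans (ler_norm_sum _ _ _))// big_nat.
under eq_bigr => n /andP[n0 _].
  rewrite eps_thue_morse// normrM norm_thue_morse norm_expi mulr1.
  over.
by rewrite -big_nat sumr_const_nat subn1.
Qed.

(** Block lengths have to be powers of two, so (log X)^(2c) is only met up to a
    factor of two. *)
Lemma pow2_between (R : realType) (Y : R) :
  1 <= Y -> exists k, Y <= (2 ^ k)%:R <= 2 * Y.
Proof.
move=> Y1; have Y0 : 0 <= Y by rewrite (le_trans _ Y1).
have [tY Yt] := andP (truncn_itv Y0).
have t0 : (0 < Num.truncn Y)%N by rewrite truncn_gt0.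
have /andP[lo hi] := trunc_log_bounds (isT : (1 < 2)%N) t0.
exists (trunc_log 2 (Num.truncn Y)).+1; apply/andP; split.
  by rewrite (le_trans (ltW Yt))// ler_nat.
by rewrite expnS natrM ler_wpM2l// (le_trans _ tY)// ler_nat.
Qed.

(** Here V stands for (log X)^c and K for the block length, of size about V^2:
    the diagonal term M^2 K is at most X^2 / K <= (X / V)^2, and the
    off-diagonal one is small because q has a factor V^4 to spare. *)
Lemma main_term_le (R : realType) (X V K M q y : R) :
  0 < V -> 0 < X -> V ^+ 2 <= K <= 2 * V ^+ 2 -> 0 <= M -> M * K <= X ->
  0 <= q -> q <= X / V ^+ 4 -> y ^+ 2 <= M * (K * (M + K * (4 * q))) ->
  y <= 3 * (X / V).
Proof.
move=> V0 X0 /andP[VK KV] M0 MK q0 qX yle.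
have V2 : 0 < V ^+ 2 by rewrite exprn_gt0.
have K0 : 0 < K by rewrite (lt_le_trans V2).
have MK0 : 0 <= M * K by rewrite mulr_ge0// ltW.
have Z0 : 0 <= X / V by rewrite divr_ge0// ltW.
rewrite leNgt; apply/negP => ylt.
have : (3 * (X / V)) ^+ 2 < y ^+ 2 by rewrite ltrXn2r //= ; lra.
rewrite ltNge (le_trans yle)//.
have -> : M * (K * (M + K * (4 * q))) =
    (M * K) ^+ 2 / K + M * K * (4 * (K * q)) by field; rewrite gt_eqF.
have -> : (3 * (X / V)) ^+ 2 =
    X ^+ 2 / V ^+ 2 + X * (4 * (2 * V ^+ 2 * (X / V ^+ 4))).
  by field; rewrite gt_eqF.
apply: lerD.
  apply: ler_pM; rewrite ?sqr_ge0 ?invr_ge0 ?(ltW K0)//.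
    by rewrite lerXn2r// ?nnegrE ltW.
  by rewrite lef_pV2 ?posrE.
have K2 := ltW K0; apply: ler_pM => //; first by rewrite !mulr_ge0.
by rewrite ler_wpM2l// ler_pM.
Qed.

Theorem theorem1 (R : realType) (c : R) (hc : 0 < c) :
  exists A B C : R, [/\ 0 < A, 0 < B, 0 < C &
    forall (X alpha : R) (a q : int) (theta : R),
      2 < X ->
      1 <= q ->
      alpha = a%:~R / q%:~R + theta / q%:~R ^+ 2 ->
      coprimez a q ->
      `|theta| < 1 ->
      ln X `^ A < q%:~R ->
      q%:~R <= X * ln X `^ (- B) ->
      `|weyl_sum_eps X alpha| <= (C * X * ln X `^ (- c))%:C].
Proof.
have [W [W0 WP]] : exists W : R,
    0 <= W /\ forall x, 0 <= x -> x <= 256 -> x `^ c <= W.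
  exists (256 `^ c); split=> [|x x0 x256]; first exact: powR_ge0.
  exact: (ge0_ler_powR (ltW hc) x0 (ler0n R 256) x256).
(* W takes care of log X < 256.  When log X >= 256, the main term gives 3 and
   the incomplete block 2; the extra factor log X >= 256 in the lower bound
   (log X)^A for q absorbs 64 R^2 / (log X)^(4c) <= 256. *)
exists (c * 4 + 1), (c * 4), (5 + W).
split; [lra|lra|lra|].
move=> X alpha a q theta X2 q1 alphaE aq th Aq qB.
have X0 : 0 < X by lra.
have L0 : 0 < ln X by rewrite ln_gt0; lra.
set L := ln X in L0 Aq qB *.
rewrite powRN; set V := L `^ c.
have V0 : 0 < V by rewrite powR_gt0.
have XV0 : 0 < X / V by rewrite divr_gt0.
have V4 : L `^ (c * 4) = V ^+ 4 by rewrite powRrM powR_mulrn// ltW.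
have [L256|L256] := ltP L 256.
  apply: (le_trans (@weyl_sum_eps_trivial _ _ _ (ltW X0))); rewrite lecR.
  have VW : V <= W by apply: WP; exact: ltW.
  rewrite ler_pdivlMr// mulrC ler_pM2r//.
  lra.
have V1 : 1 <= V.
  by rewrite /V -(powRr0 L) ler_powR// ?ltW//; lra.
have V2 : 1 <= V ^+ 2 by rewrite exprn_ege1.
have [k /andP[lo hi]] := @pow2_between _ _ V2.
set K := (2 ^ k)%N in lo hi *.
have K0 : 0 < K%:R :> R by lra.
have qlo : V ^+ 4 * 256 < q%:~R.
  apply: le_lt_trans Aq; rewrite powRD; last by rewrite (gt_eqF L0) implybT.
  by rewrite V4 powRr1 ?(ltW L0)// ler_wpM2l// exprn_ge0// ltW.
have qhi : q%:~R <= X / V ^+ 4 by rewrite -V4 -powRN.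
have K2 : K%:R ^+ 2 <= 4 * V ^+ 4 :> R.
  have -> : 4 * V ^+ 4 = (2 * V ^+ 2) ^+ 2 by ring.
  by rewrite lerXn2r// ?nnegrE; lra.
have Kq : 64 * K%:Z ^+ 2 <= q.
  rewrite -(ler_int R) intrM rmorphXn /= -pmulrn.
  lra.
have K1 : 1 <= K%:R :> R by lra.
have Kle : K%:R <= X / V.
  apply: (@le_trans _ _ (X / V ^+ 4)).
    apply: le_trans qhi; apply: le_trans (ltW qlo).
    have K_le_K2 : K%:R <= K%:R ^+ 2 :> R by rewrite ler_eXnr.
    by have := exprn_gt0 4 V0; lra.
  by rewrite ler_pM2l// lef_pV2 ?posrE ?exprn_gt0// ler_eXnr.
apply: (le_trans (@weyl_sum_eps_block _ _ _ k)); rewrite -/K.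
set M := (_ %/ K)%N.
have := @thue_morse_block_bound R a q theta k M aq th Kq.
rewrite -alphaE -/K /=.
set S := \sum_(0 <= n < _) _ => Sle.
have [y Sy] : exists y : R, `|S| = y%:C by apply/complex_realP.
move: Sle; rewrite Sy -rmorphXn lecR /= => yle.
have MK : M%:R * K%:R <= X.
  rewrite -natrM (@le_trans _ _ (Num.truncn X)%:R) ?ler_nat ?leq_trunc_div//.
  by rewrite truncn_le ltW.
have ylt : y <= 3 * (X / V).
  apply: (@main_term_le _ X V K%:R M%:R q%:~R) => //; first by rewrite lo hi.
  by rewrite ler0z (le_trans _ q1).
rewrite -(rmorph_nat (real_complex R)) -rmorphD lecR natrM.
rewrite -mulrA mulrDl.
have : 0 <= W * (X / V) by rewrite mulr_ge0// ltW.
lra.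
Qed.
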